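(* Let $R$ be an associative ring with identity and let $a,b,c,d\in R$ satisfy $$(ac)^2=(db)(ac),\quad (db)^2=(ac)(db),\quad b(ac)a=b(db)a,\quad c(ac)d=c(db)d.$$ Then $1-bd\in R^D$ if and only if $1-ac\in R^D$. In this case, writing $\alpha=1-bd$ (the inverse below existing), $$(1-ac)^{D}=\big[1-d\alpha^{\pi}\big(1-\alpha^{\pi}\alpha (1+bd)\big)^{-1}bac\big](1+ac)+d(1-bd)^D bac,$$ and $$i(1-bd)\leq i(1-ac)+1.$$
   Context: Let $R$ be an associative ring with identity. For $a\in R$, $comm(a)=\{x\in R : xa=ax\}$. The Drazin inverse of $a\in R$, if it exists, is the unique element $a^D\in R$ such that $a^D=a^Daa^D$, $a^D\in comm(a)$, and $a^k=a^{k+1}a^D$ for some $k\in\mathbb{N}=\{1,2,\dots\}$. The smallest such $k$ is the Drazin index of $a$, denoted $i(a)$. $R^D$ denotes the set of all Drazin invertible elements of $R$. For $a\in R^D$, $a^{\pi}=1-aa^D$. *)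

(* Defs.v *)
From mathcomp Require Import all_boot all_algebra.
From mathcomp Require Import boolp classical_sets.
Set Implicit Arguments. Unset Strict Implicit. Unset Printing Implicit Defensive.
Import GRing.Theory.
Local Open Scope ring_scope.

(* Rings are pzRingType, so that the zero ring is not excluded. *)

Definition is_drazin (R : pzRingType) (a x : R) : Prop :=
  [/\ x = x * a * x,
      GRing.comm x a &
      exists2 k : nat, (0 < k)%N & a ^+ k = a ^+ k.+1 * x].

Definition drazin_invertible (R : pzRingType) (a : R) : Prop :=
  exists x : R, is_drazin a x.

(* Junk value 0 when a is not Drazin invertible. *)
Definition drazin (R : pzRingType) (a : R) : R :=
  xget 0 [set x | is_drazin a x]%classic.

(* Exponents start at 1, so an invertible element has Drazin index 1. *)
Definition drazin_exponent (R : pzRingType) (a : R) (k : nat) : Prop :=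
  (0 < k)%N /\ a ^+ k = a ^+ k.+1 * drazin a.

(* Junk value 0 when a is not Drazin invertible. *)
Definition drazin_index (R : pzRingType) (a : R) : nat :=
  xget 0%N [set k | drazin_exponent a k /\
                    forall j, drazin_exponent a j -> (k <= j)%N]%classic.

Definition drazin_pi (R : pzRingType) (a : R) : R := 1 - a * drazin a.

(* Units of a pzRingType carry no library structure, hence this predicate. *)
Definition is_inverse (R : pzRingType) (v u : R) : Prop :=
  u * v = 1 /\ v * u = 1.

Lemma is_inverse_unique (R : pzRingType) (v u w : R) :
  is_inverse v u -> is_inverse v w -> u = w.
Proof. by move=> [uv _] [_ vw]; rewrite -[u]mulr1 -vw mulrA uv mul1r. Qed.

Lemma is_drazin_unique (R : pzRingType) (a x y : R) :
  is_drazin a x -> is_drazin a y -> x = y.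
Proof.
have lift (z : R) k n : (k <= n)%N -> a ^+ k = a ^+ k.+1 * z ->
    a ^+ n = a ^+ n.+1 * z.
  by move=> /subnK <- e; rewrite -addnS !exprD -mulrA -e.
have powK (z : R) n : z = z * a * z -> GRing.comm z a -> z ^+ n.+1 * a ^+ n = z.
  move=> e zC; elim: n => [|n IH]; first by rewrite expr1 expr0 mulr1.
  by rewrite (exprS z) (exprSr a) mulrA -(mulrA z) IH -mulrA zC mulrA -e.
move=> [ex xC [k _ ek]] [ey yC [l _ el]].
have {}ek := lift _ _ _ (leq_maxl k l) ek.
have {}el := lift _ _ _ (leq_maxr k l) el.
set n := maxn k l in ek el.
have xE : x = x * a * y.
  by rewrite -{1}(powK x n ex xC) el (exprSr a) !mulrA powK.
have yE : y = x * a * y.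
  have c (z : R) i j : GRing.comm z a -> GRing.comm (z ^+ i) (a ^+ j).
    by move=> zC; apply/commrX/commr_sym/commrX/commr_sym.
  rewrite -{1}(powK y n ey yC) (c y _ _ yC) ek.
  have := c x 1%N n.+1 xC; rewrite expr1 => <-.
  rewrite (exprS a) mulrA.
  by rewrite -mulrA -(c y _ _ yC) powK.
by rewrite xE -yE.
Qed.

Lemma drazinP (R : pzRingType) (a : R) :
  drazin_invertible a -> is_drazin a (drazin a).
Proof. exact: (@xgetPex _ 0 [set x | is_drazin a x]%classic). Qed.

Lemma drazinE (R : pzRingType) (a x : R) : is_drazin a x -> drazin a = x.
Proof. by move=> ax; apply: (is_drazin_unique _ ax); apply: drazinP; exists x. Qed.

Lemma drazin_indexP (R : pzRingType) (a : R) : drazin_invertible a ->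
  drazin_exponent a (drazin_index a) /\
  forall j, drazin_exponent a j -> (drazin_index a <= j)%N.
Proof.
move=> /drazinP[_ _ [k k0 ek]].
have ex : exists k, `[< drazin_exponent a k >] by exists k; apply/asboolP.
case: (ex_minnP ex) => m /asboolP am mmin.
apply: (@xgetPex _ 0%N [set k | drazin_exponent a k /\
  forall j, drazin_exponent a j -> (k <= j)%N]%classic).
by exists m; split=> // j /asboolP; exact: mmin.
Qed.

(* Main.v *)
Require Import Defs.
From mathcomp Require Import all_boot all_algebra.
Set Implicit Arguments. Unset Strict Implicit. Unset Printing Implicit Defensive.
Import GRing.Theory.
Local Open Scope ring_scope.

(** Put [x = ac] and [y = db].  The relations [x^2 = yx] and [y^2 = xy] give
    [f(y) y x = f(x) x^2] for every polynomial [f], so that, formally,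
    [1/(1 - x) = 1 + x + x^2/(1 - x) = 1 + x + d (1/(1 - bd)) b x].
    This is the asserted formula when [alpha = 1 - bd] is invertible.

    In general let [p] be the spectral idempotent of [alpha].  On the corner cut
    out by [p], [alpha] is nilpotent, hence [bd = 1 - alpha] is invertible, and
    [p alpha (1 + bd) = p - p (bd)^2] shows that [1 - p alpha (1 + bd)] is
    [(bd)^2] on this corner and [1] on the complementary one.  So its inverse
    [u] exists and satisfies [p u (bd)^2 = p].  The element [q = d p u b x] then
    is the spectral idempotent of [1 - x]: it is the expected correction, and
    [q (1 - x)^k = d p u alpha^k b x] because [b x (1 - x) = alpha b x].
    This is [drazin_transfer]; every Drazin exponent of [1 - bd] is one of
    [1 - x].

    The transfer can be run backwards.  Since the relations between [x] and [y]
    are symmetric, it leads from [1 - x = 1 - 1 x] to [1 - y], and Jacobson's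
    case [x = db] of the same lemma, with [b] and [d] exchanged, leads from
    [1 - y = 1 - db] to [1 - bd].  Each passage preserves Drazin exponents, so
    the two Drazin indices coincide. *)

Lemma is_inverse_comm (R : pzRingType) (v u r : R) :
  is_inverse v u -> GRing.comm r v -> GRing.comm r u.
Proof.
move=> [uv vu] rv.
by rewrite /GRing.comm -[LHS]mul1r -uv -mulrA (mulrA v) -rv -!mulrA vu mulr1.
Qed.

Lemma is_inverse_subr1_nilpotent (R : pzRingType) (n : R) k :
  n ^+ k = 0 -> exists u, is_inverse (1 - n) u.
Proof.
move=> nk; exists (\sum_(i < k) n ^+ i).
have sC : GRing.comm (\sum_(i < k) n ^+ i) (1 - n).
  apply/commr_sym/commr_sum => i _; apply/commrX/commr_sym.
  by apply: commrB; [exact: commr1 | exact: commr_refl].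
suff e : (1 - n) * \sum_(i < k) n ^+ i = 1 by split; rewrite ?sC.
by rewrite -opprB mulNr -subrX1 nk sub0r opprK.
Qed.

Section SpectralIdempotent.
Context (R : pzRingType).
Implicit Types a x q : R.

(** An exponent is a power that kills the spectral idempotent. *)
Lemma drazin_exponent_pi a x k : is_drazin a x ->
  a ^+ k = a ^+ k.+1 * x <-> (1 - a * x) * a ^+ k = 0.
Proof.
move=> [_ xC _].
have -> : (1 - a * x) * a ^+ k = a ^+ k - a ^+ k.+1 * x.
  by rewrite mulrBl mul1r -mulrA (commrX k xC) mulrA -exprS.
by split=> [<-|/subr0_eq //]; rewrite subrr.
Qed.

Lemma drazin_pi_drazin a : drazin_invertible a -> drazin_pi a * drazin a = 0.
Proof. by case/drazinP=> e C _; rewrite mulrBl mul1r -C -e subrr. Qed.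

Lemma drazin_pi_idem a : drazin_invertible a ->
  drazin_pi a * drazin_pi a = drazin_pi a.
Proof.
move=> Da; have [_ C _] := drazinP Da.
by rewrite {2}/drazin_pi -C mulrBr mulr1 mulrA drazin_pi_drazin // mul0r subr0.
Qed.

Lemma comm_drazin_pi a x : GRing.comm x a -> GRing.comm x (drazin a) ->
  GRing.comm x (drazin_pi a).
Proof. by move=> xa xD; apply: commrB; [exact: commr1 | exact: commrM]. Qed.

(** Recognises a Drazin inverse from a candidate [q] for [drazin_pi a]. *)
Lemma is_drazin_of_spectral a x q k : GRing.comm x a -> x * a = 1 - q ->
  q * x = 0 -> (0 < k)%N -> q * a ^+ k = 0 -> is_drazin a x.
Proof.
move=> xC xa qx k0 qk; split=> //; first by rewrite xa mulrBl mul1r qx subr0.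
exists k => //; rewrite exprS -mulrA -(commrX k xC) mulrA -xC xa.
by rewrite mulrBl mul1r qk subr0.
Qed.

End SpectralIdempotent.

Section Transfer.
Context (R : pzRingType).
Implicit Types b d x D p u : R.

(** The subtracted term is nilpotent, since [p] is idempotent, [p alpha] is
    nilpotent and everything commutes. *)
Lemma drazin_pi_inverse_one_add (z : R) : let alpha := 1 - z in
  drazin_invertible alpha ->
  exists u, is_inverse (1 - drazin_pi alpha * alpha * (1 + z)) u.
Proof.
move=> alpha aD; have Dr := drazinP aD; have [_ DC [k k0 ek]] := Dr.
set s := 1 + z.
have Cs r : GRing.comm r alpha -> GRing.comm r s.
  have -> : s = 1 + (1 - alpha) by rewrite /alpha opprB (addrC 1 (z - 1)) subrK.
  move=> ra; apply: commrD; first exact: commr1.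
  by apply: commrB; [exact: commr1 |].
have [/(_ ek) pk _] := drazin_exponent_pi k Dr; rewrite -/(drazin_pi alpha) in pk.
have pa := commr_sym (comm_drazin_pi (commr_refl _) (commr_sym DC)).
have pX j : drazin_pi alpha ^+ j.+1 = drazin_pi alpha.
  by elim: j => [|j IH]; rewrite ?expr1 // exprS IH drazin_pi_idem.
apply: (@is_inverse_subr1_nilpotent _ _ k).
rewrite exprMn_comm; last first.
  by apply/commr_sym/commrM; apply/commr_sym/Cs => //; exact: commr_refl.
by rewrite exprMn_comm // -(prednK k0) pX (prednK k0) pk mul0r.
Qed.

(** The algebra behind the transfer, with [z = bd] and [p], [u], [D] known only
    through the identities they satisfy.  From [x d b = d b d b] one gets
    [x d z = y d z] with [y = db], that is, left multiplication by [x] and by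
    [y] agree on [d b] and on [d z R].  This reaches [d p], because
    [p = z z p u], and [d D b], because [D = 1 - p + z D].  In the products
    so obtained [y] moves to the right through [d p u b] or [d D b] and meets
    [x] as [y x = x x], so that [x] commutes with [q] and with [d D b x]. *)
Lemma transfer_identities b d x D p u :
  x ^+ 2 = d * b * x -> (d * b) ^+ 2 = x * (d * b) ->
  GRing.comm D (b * d) -> GRing.comm p (b * d) -> GRing.comm u (b * d) ->
  GRing.comm u p -> D * (1 - b * d) = 1 - p -> p * D = 0 ->
  p * u * (b * d) * (b * d) = p ->
  let q := d * p * u * b * x in
  let h := (1 - q) * (1 + x) + d * D * b * x in
  [/\ GRing.comm h (1 - x), h * (1 - x) = 1 - q & q * h = 0].
Proof.
have [z zE] : exists z, b * d = z by exists (b * d).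
rewrite zE => hx hy DC pC uC uP Da pD puz q h.
(* Left-associated words are normalised by moving [z] before [p], [u], [D]
   and [p] before [u]. *)
have bd t : t * b * d = t * z by rewrite -zE mulrA.
have Dz t : t * D * z = t * z * D by rewrite -!mulrA DC.
have pz t : t * p * z = t * z * p by rewrite -!mulrA pC.
have uz t : t * u * z = t * z * u by rewrite -!mulrA uC.
have up t : t * u * p = t * p * u by rewrite -!mulrA uP.
have pp : p * p = p.
  apply/eqP; rewrite eq_sym -subr_eq0 -{1}[p]mulr1 -mulrBr -Da mulrA pD.
  by rewrite mul0r.
have ppt t : t * p * p = t * p by rewrite -mulrA pp.
have zzpu t : t * z * z * p * u = t * p.
  by rewrite -[in RHS]puz !mulrA uz pz uz pz.
have xx t : t * x * x = t * d * b * x.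
  by rewrite -(mulrA t x x) -expr2 hx !mulrA.
have xdb : x * d * b = d * z * b.
  by rewrite -(mulrA x) -hy expr2 !mulrA bd.
have xdz : x * d * z = d * z * z.
  by rewrite -{1}zE mulrA xdb bd.
(* [p] is a left multiple of [z], so [xdz] applies to it. *)
have xdp : x * d * p = d * z * p.
  by rewrite -[in LHS](zzpu (x * d)) xdz -[in RHS](zzpu (d * z)).
have DE : D = 1 - p + z * D by rewrite -Da mulrBr mulr1 DC subrK.
have xdD : x * d * D * b = d * z * D * b.
  rewrite DE !(mulrDr, mulrDl, mulrN, mulNr, mulr1, mulrA) xdp xdz.
  by rewrite xdb.
have xq : x * q = d * z * p * u * b * x by rewrite /q !mulrA xdp.
have qx : q * x = d * z * p * u * b * x.
  by rewrite /q xx bd uz pz.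
have qC : x * q = q * x by rewrite xq qx.
have qq : q * q = q.
  by rewrite {1}/q -mulrA xq !mulrA bd !(uz, pz, up, ppt) zzpu.
have qxx : q * x * x = d * p * b * x.
  by rewrite qx xx bd uz pz zzpu.
have xw : x * (d * D * b * x) = d * z * D * b * x by rewrite !mulrA xdD.
have wx : d * D * b * x * x = d * z * D * b * x by rewrite xx bd Dz.
have hC : GRing.comm h x.
  rewrite /GRing.comm /h [LHS]mulrDl [RHS]mulrDr wx xw; congr (_ + _).
  rewrite -mulrA [(1 + x) * x]mulrDl mul1r -{1}[x]mulr1 -mulrDr !mulrA.
  by rewrite mulrBl mulrBr mul1r mulr1 qC.
split; first by apply: commrB; [exact: commr1 | ].
- have Dx : d * D * b * x * (1 - x) = d * b * x - d * p * b * x.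
    rewrite mulrBr mulr1 wx -Dz -!mulrBl -[d * D * z]mulrA -mulrBr.
    by rewrite -{1}[D]mulr1 -mulrBr Da mulrBr mulr1.
  have xE : (1 + x) * (1 - x) = 1 - d * b * x.
    by rewrite mulrDl mul1r mulrBr mulr1 addrA subrK -expr2 hx.
  rewrite /h [LHS]mulrDl Dx -mulrA xE mulrBl mul1r mulrBr mulr1.
  have -> : q * (d * b * x) = d * p * b * x by rewrite -hx expr2 mulrA.
  by rewrite opprB -addrA [_ - q + _]addrC [X in _ + X]addrA subrK addrA subrK.
- rewrite /h mulrDr (mulrA q (1 - q)) (mulrBr q) mulr1 qq subrr mul0r add0r.
  have -> : q * (d * D * b * x) = d * p * u * b * (x * d * D * b) * x.
    by rewrite /q !mulrA.
  rewrite xdD !mulrA bd !(uz, pz) zzpu -(mulrA d) pD.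
  by rewrite mulr0 !mul0r.
Qed.

(** For [x = db] this is Jacobson's lemma for Drazin inverses; in general [x] is
    only tied to [db] by two quadratic relations, and [h] is obtained by
    correcting [1 + x + x^2/(1 - x)] on the nilpotent corner of [alpha]. *)
Lemma drazin_transfer b d x u : let alpha := 1 - b * d in
  x ^+ 2 = d * b * x -> (d * b) ^+ 2 = x * (d * b) ->
  drazin_invertible alpha ->
  is_inverse (1 - drazin_pi alpha * alpha * (1 + b * d)) u ->
  let h := (1 - d * drazin_pi alpha * u * b * x) * (1 + x)
           + d * drazin alpha * b * x in
  is_drazin (1 - x) h /\
  forall k, drazin_exponent alpha k -> drazin_exponent (1 - x) k.
Proof.
move=> alpha hx hy aD; have Dr := drazinP aD.
have pp := drazin_pi_idem aD; have pD := drazin_pi_drazin aD.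
set D := drazin alpha in Dr pD *; have [D1 DC [k k0 ek]] := Dr.
set p := drazin_pi alpha in pp pD *; set z := b * d => uI h.
have za : z = 1 - alpha by rewrite /alpha opprB addrC subrK.
have Cz r : GRing.comm r alpha -> GRing.comm r z.
  by rewrite za => ra; apply: commrB; [exact: commr1 |].
have pa : GRing.comm p alpha.
  by apply/commr_sym/comm_drazin_pi; [exact: commr_refl | exact: commr_sym].
have ua : GRing.comm u alpha.
  apply/commr_sym/(is_inverse_comm uI)/commrB; first exact: commr1.
  apply: commrM; first by apply: commrM; [exact: commr_sym | exact: commr_refl].
  by apply: commrD; [exact: commr1 | apply: Cz; exact: commr_refl].
have up : GRing.comm u p.
  apply/commr_sym/(is_inverse_comm uI)/commrB; first exact: commr1.
  apply: commrM; first by apply: commrM; [exact: commr_refl |].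
  by apply: commrD; [exact: commr1 | exact: Cz].
have Da : D * alpha = 1 - p by rewrite /p /drazin_pi opprB addrC subrK DC.
(* On the corner of [p], the element inverted by [u] is [z z]. *)
have puz : p * u * z * z = p.
  have [uv _] := uI.
  have zz : 1 - alpha * (1 + z) = z * z.
    by rewrite /alpha mulrDr mulr1 mulrBl mul1r addrA subrK opprB addrC subrK.
  have pw : p * (1 - p * alpha * (1 + z)) = p * (z * z).
    by rewrite -zz [LHS]mulrBr [RHS]mulrBr -(mulrA p alpha) (mulrA p p) pp.
  by rewrite -up -(mulrA _ z) -(mulrA u) -pw mulrA up -mulrA uv mulr1.
have [hC ha qh] := transfer_identities hx hy (Cz _ DC) (Cz _ pa) (Cz _ ua) up
  Da pD puz; rewrite -/h in hC ha qh.
(* Since [b x (1 - x) = alpha b x], powers of [1 - x] pass through [b x]. *)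
have bxX j : b * x * (1 - x) ^+ j = alpha ^+ j * b * x.
  elim: j => [|j IH]; first by rewrite !expr0 mulr1 mul1r.
  rewrite exprSr mulrA IH exprSr -!mulrA; congr (_ * _).
  by rewrite mulrBr mulr1 -expr2 hx mulrBr [in RHS]/alpha mulrBl mul1r !mulrA.
have qX j : alpha ^+ j = alpha ^+ j.+1 * D ->
    d * p * u * b * x * (1 - x) ^+ j = 0.
  move=> /(drazin_exponent_pi j Dr); rewrite -/p => pj.
  have -> : d * p * u * b * x = d * (u * p) * (b * x) by rewrite up !mulrA.
  rewrite -mulrA bxX -mulrA -(mulrA u) (mulrA p) (mulrA p) pj.
  by rewrite !mul0r !mulr0.
have hD : is_drazin (1 - x) h by exact: is_drazin_of_spectral hC ha qh k0 (qX k ek).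
split=> // j [j0 ej]; split=> //; rewrite (drazinE hD).
by apply/(drazin_exponent_pi j hD); rewrite -hC ha opprB addrC subrK; exact: qX.
Qed.

(** An inverse [u] as in [drazin_transfer] always exists, which leaves only the
    assumption that [1 - bd] is Drazin invertible. *)
Lemma drazin_transfer_index b d x :
  x ^+ 2 = d * b * x -> (d * b) ^+ 2 = x * (d * b) ->
  drazin_invertible (1 - b * d) ->
  drazin_invertible (1 - x) /\
  (drazin_index (1 - x) <= drazin_index (1 - b * d))%N.
Proof.
move=> hx hy aD.
have [u uI] := drazin_pi_inverse_one_add aD.
have [hD hk] := drazin_transfer hx hy aD uI.
have xD : drazin_invertible (1 - x) by eexists; exact: hD.
split=> //; have [ak _] := drazin_indexP aD.
by have [_] := drazin_indexP xD; apply; exact: hk.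
Qed.

(** Relations [x^2 = yx] and [y^2 = xy] with [y = db] reverse the transfer:
    first from [1 - x] to [1 - db], then by Jacobson's case to [1 - bd]. *)
Lemma drazin_transfer_index_inv b d x :
  x ^+ 2 = d * b * x -> (d * b) ^+ 2 = x * (d * b) ->
  drazin_invertible (1 - x) ->
  drazin_invertible (1 - b * d) /\
  (drazin_index (1 - b * d) <= drazin_index (1 - x))%N.
Proof.
move=> hx hy xD.
have [yD yk] : drazin_invertible (1 - d * b) /\
    (drazin_index (1 - d * b) <= drazin_index (1 - x))%N.
  (* The roles of [x] and [db] are exchanged through the factorisation [1 x]. *)
  by have := @drazin_transfer_index 1 x (d * b); rewrite mulr1 mul1r; apply.
(* Exchanging [b] and [d], with [bd] in the role of [x], the relations are trivial. *)
have [zD zk] := drazin_transfer_index (expr2 (b * d)) (expr2 (b * d)) yD.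
by split=> //; exact: leq_trans zk yk.
Qed.

End Transfer.

Theorem theorem3p1 (R : pzRingType) (a b c d : R)
  (h1 : (a * c) ^+ 2 = (d * b) * (a * c))
  (h2 : (d * b) ^+ 2 = (a * c) * (d * b))
  (h3 : b * (a * c) * a = b * (d * b) * a)
  (h4 : c * (a * c) * d = c * (d * b) * d) :
  (drazin_invertible (1 - b * d) <-> drazin_invertible (1 - a * c)) /\
  (drazin_invertible (1 - b * d) ->
    let alpha := 1 - b * d in
    (exists2 u : R, is_inverse (1 - drazin_pi alpha * alpha * (1 + b * d)) u &
       drazin (1 - a * c) =
         (1 - d * drazin_pi alpha * u * b * a * c) * (1 + a * c)
         + d * drazin (1 - b * d) * b * a * c) /\
    (drazin_index (1 - b * d) <= drazin_index (1 - a * c) + 1)%N).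
Proof.
split; first split=> [zD|xD].
- by case: (drazin_transfer_index h1 h2 zD).
- by case: (drazin_transfer_index_inv h1 h2 xD).
move=> zD alpha; split.
  have [u uI] := drazin_pi_inverse_one_add zD; exists u => //.
  by have [/drazinE ->] := drazin_transfer h1 h2 zD uI; rewrite !mulrA.
have [xD _] := drazin_transfer_index h1 h2 zD.
have [_ zk] := drazin_transfer_index_inv h1 h2 xD.
by rewrite addn1 ltnW.
Qed.
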